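(* Let $\mathbf X$ be a rough path cocycle and $\mathbf Z$ an $\mathbf X$-controlled rough path cocycle over an invertible measure-preserving dynamical system, let $F\in C_b^3(W,\mathcal L(U,W))$ and $F_0\in C_b^1(W,W)$, and for $\omega\in\Omega$ let $\mathbf Y(\omega)=(Y(\omega),Y'(\omega))$ be the $\mathbf X(\omega)$-controlled path on $\mathbb R$ satisfying $$Y_t(\omega)=Y_0(\omega)+\int_0^tF(Y_r(\omega))\,d\mathbf Z_r(\omega)+\int_0^tF_0(Y_r(\omega))\,dr,\qquad Y'_t(\omega)=F(Y_t(\omega))Z'_t(\omega).$$ For fixed $s\in\mathbb R$ put $\widetilde{\mathbf Y}_r(\omega)=(\widetilde Y_r(\omega),\widetilde Y'_r(\omega)):=\mathbf Y_{s+r}(\omega)$, $r\in\mathbb R$. Then for all $t\in\mathbb R$: 1. $\displaystyle\int_s^{s+t}F(Y_q(\omega))\,d\mathbf Z_q(\omega)=\int_0^tF(\widetilde Y_r(\omega))\,d\mathbf Z_r(\theta_s\omega)$; 2. $\displaystyle\int_s^{s+t}F_0(Y_q(\omega))\,dq=\int_0^tF_0(\widetilde Y_r(\omega))\,dr$.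
   Context: $U,V,W$ are finite-dimensional Banach spaces, $\alpha\in(1/3,1/2]$, $X_{s,t}:=X_t-X_s$. $C_b^k$ denotes $k$-times continuously differentiable maps with bounded derivatives up to order $k$. An invertible measure-preserving dynamical system is a probability space $(\Omega,\mathcal F,\mathbb P)$ with measurable, $\mathbb P$-preserving maps $\theta_t$, $t\in\mathbb R$, with $\theta_0=\mathrm{id}$, $\theta_{t+s}=\theta_t\circ\theta_s$ and $(t,\omega)\mapsto\theta_t\omega$ jointly measurable. An $\alpha$-Hölder rough path $\mathbf X=(X,\mathbb X)$: $X$ is $V$-valued and $\alpha$-Hölder, $\mathbb X$ is $V\otimes V$-valued with $\sup\|\mathbb X_{s,t}\|/|t-s|^{2\alpha}<\infty$, and $\mathbb X_{s,t}=\mathbb X_{s,u}+\mathbb X_{u,t}+X_{s,u}\otimes X_{u,t}$. An $\mathbf X$-controlled path is $(Z,Z')$ with $Z'$ $\alpha$-Hölder and $R^Z_{s,t}=Z_{s,t}-Z'_sX_{s,t}$ satisfying $\sup\|R^Z_{s,t}\|/|t-s|^{2\alpha}<\infty$. On $\mathbb R$ these conditions are required on every compact interval. A rough path cocycle is a random process $\mathbf X=(X,\mathbb X)$ with each $\mathbf X(\omega)$ an $\alpha$-Hölder rough path on $\mathbb R$ over $V$ and $X_{s,s+t}(\omega)=X_{0,t}(\theta_s\omega)$, $\mathbb X_{s,s+t}(\omega)=\mathbb X_{0,t}(\theta_s\omega)$ for $s\in\mathbb R,t\ge0$. An $\mathbf X$-controlled rough path cocycle is a random process $\mathbf Z=(Z,Z')$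 with values in $U\times\mathcal L(V,U)$, each $\mathbf Z(\omega)$ being $\mathbf X(\omega)$-controlled on $\mathbb R$, and $Z_{s,s+t}(\omega)=Z_{0,t}(\theta_s\omega)$, $Z'_{s+t}(\omega)=Z'_t(\theta_s\omega)$ for $s\in\mathbb R,t\ge0$. Controlled integral: $\int_a^bF(Y_r)\,d\mathbf Z_r:=\lim_{|\mathcal P|\to0}\sum_{[u,v]\in\mathcal P}\bigl(F(Y_u)Z_{u,v}+DF(Y_u)Y'_uZ'_u\mathbb X_{u,v}\bigr)$ for $a<b$, and $\int_a^b:=-\int_b^a$ for $b<a$. In the right-hand integral of item 1, $\widetilde{\mathbf Y}(\omega)$ and $\mathbf Z(\theta_s\omega)$ are regarded as controlled by $\mathbf X(\theta_s\omega)$. *)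

(* Defs.v *)
From HB Require Import structures.
From mathcomp Require Import all_boot all_order all_algebra.
From mathcomp Require Import all_classical all_reals all_analysis.
Import Order.TTheory GRing.Theory Num.Theory.
Import numFieldNormedType.Exports.

Set Implicit Arguments.
Unset Strict Implicit.
Unset Printing Implicit Defensive.

Local Open Scope classical_set_scope.
Local Open Scope ring_scope.

(** Finite-dimensional real Banach spaces; completeness is automatic in finite
    dimension. *)
#[short(type="normedVectType")]
HB.structure Definition NormedVector (R : realType) :=
  {T of NormedModule R T & Vector R T}.

HB.instance Definition _ (R : realType) := SemiVector.on R^o.

Section finite_dimension.
Context {R : realType} (V : normedVectType R).

Import VectorInternalTheory.

(* The norm of V is bounded below by that of the coordinates. *)
Lemma v2r_bounded : exists2 C : R, 0 <= C & forall x : V, `|v2r x| <= C * `|x|.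
Proof.
pose N (c : 'rV[R]_(dim V)) : R := `|r2v c : V|.
pose S := [set c : 'rV[R]_(dim V) | `|c| = 1].
have [S0|] := pselect (S !=set0); last first.
  move=> /set0P/negP; rewrite negbK => /eqP S0.
  exists 0 => // x; rewrite mul0r.
  have [->|x0] := eqVneq (v2r x) 0; first by rewrite normr0.
  suff : S (`|v2r x|^-1 *: v2r x) by rewrite S0.
  by rewrite /S /= normrZ normfV normr_id mulVf// normr_eq0.
have bN c : N c <= (\sum_i `|r2v (delta_mx 0 i) : V|) * `|c|.
  rewrite /N {1}(row_sum_delta c) linear_sum mulr_suml.
  apply: (le_trans (ler_norm_sum _ _ _)); apply: ler_sum => i _.
  rewrite linearZ normrZ mulrC ler_wpM2l//.
  rewrite [leRHS]/Num.norm/= mx_normrE; apply/bigmax_geP; right => /=.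
  by exists (0, i).
set K := \sum_i _ in bN.
have K0 : 0 <= K by apply: sumr_ge0.
have cN : continuous N.
  have cr : continuous (r2v : 'rV[R]_(dim V) -> V).
    apply: bounded_linear_continuous; apply/linear_boundedP.
    exists K; split; first exact: ger0_real.
    by move=> M KM c; rewrite (le_trans (bN c))// ler_wpM2r// ltW.
  by move=> c; apply: continuous_comp; [exact: cr | exact: norm_continuous].
have cS : compact S.
  apply: bounded_closed_compact.
    exists 1; split => // M M1 c /= ->; exact: ltW.
  rewrite (_ : S = (fun c : 'rV[R]_(dim V) => `|c|) @^-1` [set 1]).
    by apply: preimage_closed; [move=> ? _; exact: norm_continuous | exact: closed_eq].
  by [].
have [c Sc cmin] := EVT_min_rV S0 cS (continuous_subspaceT cN).
have Nc0 : 0 < N c.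
  rewrite /N normr_gt0; apply/eqP => c0.
  have cz : c = 0 by apply: (can_inj r2vK); rewrite c0 linear0.
  by move: Sc; rewrite inE /S /= cz normr0 => /esym/eqP; rewrite oner_eq0.
exists (N c)^-1; first by rewrite invr_ge0 ltW.
move=> x; have [->|x0] := eqVneq (v2r x) 0; first by rewrite normr0 mulr_ge0// invr_ge0 ltW.
have nx0 : 0 < `|v2r x| by rewrite normr_gt0.
have := cmin (`|v2r x|^-1 *: v2r x).
have -> : `|v2r x|^-1 *: v2r x \in S.
  by rewrite inE /S /= normrZ normfV normr_id mulVf// normr_eq0.
have -> : N (`|v2r x|^-1 *: v2r x) = `|v2r x|^-1 * `|x|.
  by rewrite /N linearZ/= v2rK normrZ normfV normr_id.
by move=> /(_ isT); rewrite ler_pdivlMl// ler_pdivlMl// mulrC.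
Qed.

Lemma linear_bounded_fin (W : normedModType R) (f : {linear V -> W}) :
  exists2 C : R, 0 <= C & forall x : V, `|f x| <= C * `|x|.
Proof.
have [C C0 hC] := v2r_bounded.
pose K := \sum_i `|f (r2v (delta_mx 0 i))|.
have K0 : 0 <= K by apply: sumr_ge0.
exists (K * C); first exact: mulr_ge0.
move=> x; rewrite -mulrA; apply: (@le_trans _ _ (K * `|v2r x|)); last first.
  by rewrite ler_wpM2l.
rewrite -{1}(v2rK x) {1}(row_sum_delta (v2r x)) !linear_sum mulr_suml.
apply: (le_trans (ler_norm_sum _ _ _)); apply: ler_sum => i _.
rewrite !linearZ normrZ mulrC ler_wpM2l//.
rewrite [leRHS]/Num.norm/= mx_normrE; apply/bigmax_geP; right => /=.
by exists (0, i).
Qed.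

End finite_dimension.

(** 'Hom(V, W) with the operator norm. *)
Section operator_norm.
Context {R : realType} (V W : normedVectType R).
Implicit Types f g : 'Hom(V, W).

Definition opnorm f : R := sup [set `|f x| | x in [set x : V | `|x| <= 1]].

Lemma opnorm_has_sup f : has_sup [set `|f x| | x in [set x : V | `|x| <= 1]].
Proof.
split; first by exists `|f 0|, 0 => //=; rewrite normr0.
have [C C0 hC] := linear_bounded_fin f.
exists C => _ [x /= x1 <-]; rewrite (le_trans (hC x))//.
by rewrite -[leRHS]mulr1 ler_wpM2l.
Qed.

Lemma opnorm_ub f x : `|f x| <= opnorm f * `|x|.
Proof.
have [->|x0] := eqVneq x 0; first by rewrite linear0 !normr0 mulr0.
have nx0 : 0 < `|x| by rewrite normr_gt0.
rewrite -ler_pdivrMr// mulrC -[X in X * _]gtr0_norm ?invr_gt0// -normrZ -linearZ.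
apply: sup_upper_bound; first exact: opnorm_has_sup.
exists (`|x|^-1 *: x) => //=.
by rewrite normrZ gtr0_norm ?invr_gt0// mulVf ?gt_eqF.
Qed.

Lemma opnorm_le f (C : R) : 0 <= C ->
  (forall x, `|f x| <= C * `|x|) -> opnorm f <= C.
Proof.
move=> C0 fC; apply: ge_sup; first by case: (opnorm_has_sup f).
move=> _ [x /= x1 <-]; rewrite (le_trans (fC x))//.
by rewrite -[leRHS]mulr1 ler_wpM2l.
Qed.

Lemma opnorm_ge0 f : 0 <= opnorm f.
Proof.
apply: (@le_trans _ _ `|f 0|) => //.
by apply: sup_upper_bound; [exact: opnorm_has_sup | exists 0; rewrite //= normr0].
Qed.

Lemma ler_opnormD f g : opnorm (f + g) <= opnorm f + opnorm g.
Proof.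
apply: opnorm_le => [|x]; first by rewrite addr_ge0 ?opnorm_ge0.
by rewrite add_lfunE mulrDl (le_trans (ler_normD _ _))// lerD ?opnorm_ub.
Qed.

Lemma opnormZ (a : R) f : opnorm (a *: f) = `|a| * opnorm f.
Proof.
have le_opnormZ b h : opnorm (b *: h) <= `|b| * opnorm h.
  apply: opnorm_le => [|x]; first by rewrite mulr_ge0 ?opnorm_ge0.
  by rewrite scale_lfunE normrZ -mulrA ler_wpM2l ?opnorm_ub.
apply/eqP; rewrite eq_le le_opnormZ/=.
have [->|a0] := eqVneq a 0; first by rewrite normr0 mul0r opnorm_ge0.
rewrite -ler_pdivlMl ?normr_gt0// -normfV.
by rewrite (le_trans _ (le_opnormZ _ _))// scalerA mulVf// scale1r.
Qed.

Lemma opnorm_eq0 f : opnorm f = 0 -> f = 0.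
Proof.
move=> f0; apply/lfunP => x; rewrite zero_lfunE; apply/eqP.
by rewrite -normr_le0 (le_trans (opnorm_ub f x))// f0 mul0r.
Qed.

HB.instance Definition _ :=
  Lmodule_isNormed.Build R 'Hom(V, W) ler_opnormD opnormZ opnorm_eq0.

Lemma hom_normE f : `|f| = opnorm f. Proof. by []. Qed.

End operator_norm.

(** The tensor square of V, realized (V being finite-dimensional) as the space
    of linear maps from the dual of V to V: v (x) w is the rank-one map
    phi |-> phi(v) w. *)
Section tensor_square.
Context {R : realType} (V : normedVectType R).

Definition tensor2 : normedVectType R := 'Hom('Hom(V, R^o), V).

Definition tens (v w : V) : tensor2 :=
  linfun (fun phi : 'Hom(V, R^o) => (phi v : R) *: w).

Lemma tensE v w (phi : 'Hom(V, R^o)) : tens v w phi = (phi v : R) *: w.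
Proof.
pose f (phi : 'Hom(V, R^o)) := (phi v : R) *: w.
have lf : linear f.
  by move=> a p q; rewrite /f add_lfunE scale_lfunE scalerDl scalerA.
pose fL := GRing.isLinear.Build _ _ _ _ f lf.
pose g : {linear 'Hom(V, R^o) -> V} := HB.pack f fL.
exact: (lfunE g phi).
Qed.

Definition basis_vec (i : 'I_(\dim {:V})) : V := (vbasis {:V})`_i.
Definition dual_vec (i : 'I_(\dim {:V})) : 'Hom(V, R^o) :=
  linfun (coord (vbasis {:V}) i : V -> R^o).

Lemma basis_vec_sum v : v = \sum_i (dual_vec i v : R) *: basis_vec i.
Proof.
rewrite {1}(coord_vbasis (memvf v)); apply: eq_bigr => i _.
by rewrite lfunE.
Qed.

(** The linear map on the tensor square induced by a bilinear map b; it is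
    characterized by [tensor_lift_tens] and [tens_sum]. *)
Definition tensor_lift (E : normedVectType R) (b : V -> V -> E) (T : tensor2) : E :=
  \sum_i b (basis_vec i) (T (dual_vec i)).

Lemma tensor_lift_tens (E : normedVectType R) (b : 'Hom(V, 'Hom(V, E))) v w :
  tensor_lift (fun x y => b x y) (tens v w) = b v w.
Proof.
rewrite [in RHS](basis_vec_sum v) linear_sum sum_lfunE; apply: eq_bigr => i _.
by rewrite tensE !linearZ/= scale_lfunE.
Qed.

Lemma tens_sum (T : tensor2) : T = \sum_i tens (basis_vec i) (T (dual_vec i)).
Proof.
apply/lfunP => phi; rewrite sum_lfunE.
under eq_bigr do rewrite tensE -linearZ.
rewrite -linear_sum; congr (T _); apply/lfunP => v; rewrite sum_lfunE.
rewrite {1}(basis_vec_sum v) linear_sum; apply: eq_bigr => i _.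
by rewrite linearZ/= scale_lfunE; exact: mulrC.
Qed.

End tensor_square.

Section differential_calculus.
Context {R : realType}.

Definition Dhom (W E : normedVectType R) (f : W -> E) (x : W) : 'Hom(W, E) :=
  linfun ('d f x).

Fixpoint Cb (k : nat) (W E : normedVectType R) (f : W -> E) : Prop :=
  bounded_fun f /\
  match k with
  | 0%N => continuous f
  | k'.+1 => (forall x, differentiable f x) /\ Cb k' (Dhom f)
  end.

End differential_calculus.

Section rough_paths.
Context {R : realType}.

Definition incr (E : normedVectType R) (f : R -> E) (s t : R) : E := f t - f s.

(** sup_{a <= s < t <= b} |A s t| / |t - s|^g is finite on every compact [a, b]. *)
Definition loc_holder (E : normedVectType R) (g : R) (A : R -> R -> E) : Prop :=
  forall a b : R, exists C : R,
    forall s t, a <= s -> s < t -> t <= b -> `|A s t| <= C * (t - s) `^ g.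

Definition rough_path (V : normedVectType R) (alpha : R)
    (X : R -> V) (XX : R -> R -> tensor2 V) : Prop :=
  [/\ loc_holder alpha (incr X),
      loc_holder (2 * alpha) XX &
      forall s u t, s <= u -> u <= t ->
        XX s t = XX s u + XX u t + tens (incr X s u) (incr X u t)].

Definition remainder (V U : normedVectType R) (X : R -> V)
    (Z : R -> U) (Z' : R -> 'Hom(V, U)) (s t : R) : U :=
  incr Z s t - Z' s (incr X s t).

Definition controlled (V U : normedVectType R) (alpha : R) (X : R -> V)
    (Z : R -> U) (Z' : R -> 'Hom(V, U)) : Prop :=
  loc_holder alpha (incr Z') /\ loc_holder (2 * alpha) (remainder X Z Z').

End rough_paths.

Section integrals.
Context {R : realType}.

(** Partitions of [a, b] (as sequences s such that a :: s is increasing and ends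
    at b) with mesh tending to 0. *)
Definition small_partitions (a b : R) : set_system (seq R) :=
  [set Q : set (seq R) | exists2 delta : R, 0 < delta &
    forall s, itv_partition a b s ->
      (forall i, (i < size s)%N ->
        nth b (a :: s) i.+1 - nth b (a :: s) i < delta) -> Q s].

Lemma small_partition_exists (a b delta : R) : a <= b -> 0 < delta ->
  exists2 s, itv_partition a b s & forall i, (i < size s)%N ->
    nth b (a :: s) i.+1 - nth b (a :: s) i < delta.
Proof.
move=> ab d0; pose e := delta / 2.
have e0 : 0 < e by rewrite divr_gt0.
have ed : e < delta by rewrite ltr_pdivrMr// mulr_natr mulr2n ltrDl.
have [n] : exists n : nat, b - a <= n%:R * e.
  exists (Num.truncn ((b - a) / e)).+1.
  by rewrite -ler_pdivrMr// ltW// truncnS_gt.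
elim: n a ab => [|n IH] a ab.
  rewrite mul0r subr_le0 => ba; exists [::] => //.
  by split => //=; rewrite eq_le ab ba.
have [bae _|bae hb] := lerP b (a + e).
  have [->|anb] := eqVneq a b; first by exists [::] => //; split => //=.
  exists [:: b]; first by apply: itv_partition1; rewrite lt_neqAle anb.
  by case=> //= _; rewrite (le_lt_trans _ ed)// lerBlDl.
have [|s ps ms] := IH (a + e) (ltW bae).
  by rewrite opprD addrA lerBlDr; move: hb; rewrite -natr1 mulrDl mul1r.
exists (a + e :: s).
  by case: ps => ps1 ps2; split => //=; rewrite ltrDl e0.
by case=> [_|i /ms//]; rewrite /= addrAC subrr add0r.
Qed.

Lemma small_partitions_proper (a b : R) : a <= b ->
  ProperFilter (small_partitions a b).
Proof.
move=> ab; split.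
  by move=> [delta d0 h]; have [s ps ms] := small_partition_exists ab d0; exact: h ps ms.
split; first by exists 1.
  move=> A B [d1 d10 hA] [d2 d20 hB]; exists (Num.min d1 d2).
    by rewrite lt_min d10 d20.
  move=> s ps ms; split; [apply: hA | apply: hB] => // i /ms.
    by rewrite lt_min => /andP[].
  by rewrite lt_min => /andP[].
by move=> A B AB [d1 d10 hA]; exists d1 => // s ps ms; apply/AB/hA.
Qed.

Definition partition_sum (E : normedVectType R) (Xi : R -> R -> E) (a b : R)
    (s : seq R) : E :=
  \sum_(0 <= i < size s) Xi (nth b (a :: s) i) (nth b (a :: s) i.+1).

Section controlled_integral.
Context {U V W : normedVectType R}.
Variables (F : W -> 'Hom(U, W)) (Y : R -> W) (Y' : R -> 'Hom(V, W)).
Variables (Z : R -> U) (Z' : R -> 'Hom(V, U)) (XX : R -> R -> tensor2 V).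

(** In DF(Y_u) Y'_u Z'_u XX_{u,v}, the map Y'_u acts on the first tensor factor
    and Z'_u on the second. *)
Definition germ (u v : R) : W :=
  F (Y u) (incr Z u v)
  + tensor_lift (fun x y : V => Dhom F (Y u) (Y' u x) (Z' u y)) (XX u v).

(** [lim] is total, so convergence of the compensated sums is recorded apart. *)
Definition cintegrable (a b : R) : Prop :=
  cvg (partition_sum germ (Num.min a b) (Num.max a b)
       @ small_partitions (Num.min a b) (Num.max a b)).

Definition cintegral (a b : R) : W :=
  if a <= b then lim (partition_sum germ a b @ small_partitions a b)
  else - lim (partition_sum germ b a @ small_partitions b a).

End controlled_integral.

(** The oriented integral of a vector-valued function, computed coordinatewise. *)
Definition vintegral (E : normedVectType R) (f : R -> E) (a b : R) : E :=
  let int c d : E :=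
    \sum_i (\int[lebesgue_measure]_(r in `[c, d]) coord (vbasis {:E}) i (f r))
           *: (vbasis {:E})`_i in
  if a <= b then int a b else - int b a.

End integrals.

Section cocycles.
Context {R : realType} {d : measure_display} {Omega : measurableType d}.

Record measure_preserving_system (P : probability Omega R)
    (theta : R -> Omega -> Omega) : Prop := {
  mps_measurable : forall t, measurable_fun setT (theta t);
  mps_preserving : forall t A, measurable A -> P (theta t @^-1` A) = P A;
  mps_id : forall w, theta 0 w = w;
  mps_add : forall t s w, theta (t + s) w = theta t (theta s w);
  mps_jointly_measurable :
    measurable_fun setT
      (fun p : (measurableTypeR R * Omega)%type => theta p.1 p.2)
}.

(** Measurability with respect to the Borel sigma-algebra of E. *)
Definition random_vector (E : normedVectType R) (f : Omega -> E) : Prop :=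
  measurable_fun setT (f : Omega -> g_sigma_algebraType (@open E)).

Variable theta : R -> Omega -> Omega.

Record rough_path_cocycle (V : normedVectType R) (alpha : R)
    (X : Omega -> R -> V) (XX : Omega -> R -> R -> tensor2 V) : Prop := {
  rpc_measurable1 : forall t, random_vector (fun w => X w t);
  rpc_measurable2 : forall s t, s <= t -> random_vector (fun w => XX w s t);
  rpc_rough_path : forall w, rough_path alpha (X w) (XX w);
  rpc_cocycle1 : forall w s t, 0 <= t ->
    incr (X w) s (s + t) = incr (X (theta s w)) 0 t;
  rpc_cocycle2 : forall w s t, 0 <= t ->
    XX w s (s + t) = XX (theta s w) 0 t
}.

Record controlled_cocycle (V U : normedVectType R) (alpha : R)
    (X : Omega -> R -> V)
    (Z : Omega -> R -> U) (Z' : Omega -> R -> 'Hom(V, U)) : Prop := {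
  cc_measurable1 : forall t, random_vector (fun w => Z w t);
  cc_measurable2 : forall t, random_vector (fun w => Z' w t);
  cc_controlled : forall w, controlled alpha (X w) (Z w) (Z' w);
  cc_cocycle1 : forall w s t, 0 <= t ->
    incr (Z w) s (s + t) = incr (Z (theta s w)) 0 t;
  cc_cocycle2 : forall w s t, 0 <= t -> Z' w (s + t) = Z' (theta s w) t
}.

End cocycles.

(* Main.v *)
Require Import Defs.
From HB Require Import structures.
From mathcomp Require Import all_boot all_order all_algebra.
From mathcomp Require Import all_classical all_reals all_analysis.
From mathcomp Require Import ring lra.
Import Order.TTheory GRing.Theory Num.Theory.
Import numFieldNormedType.Exports.

Set Implicit Arguments.
Unset Strict Implicit.
Unset Printing Implicit Defensive.

Local Open Scope classical_set_scope.
Local Open Scope ring_scope.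

(** Fix omega and call germ the summand F(Y_u) Z_{u,v} + DF(Y_u) Y'_u Z'_u XX_{u,v}
    of the compensated sums. The cocycle identities say that the germ of the
    shifted data, built from Y_{s+.}, Z(theta_s omega) and XX(theta_s omega), is
    the germ of the original data evaluated at (s + u, s + v) ([germ_shift]).
    Hence, when partitions of [a, b] are translated to partitions of
    [s + a, s + b], which preserves the mesh, the two compensated sums agree
    term by term, and limits carry over ([cvg_partition_sum_shift]).

    What remains is the existence of the integral over the intervals with end
    points s and s + t, given its existence from 0 to any time. No sewing
    estimate is involved: by the Cauchy criterion, convergence passes from an
    interval to its subintervals ([is_cvg_partition_sum_sub]); and it passes from
    two adjacent intervals to their union ([is_cvg_partition_sum_join]), because
    the germ vanishes at the diagonal ([germ_diag_vanishing]), so that inserting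
    the common end point in a fine partition hardly changes the sum.

    The second identity is a change of variable in a Lebesgue integral
    ([vintegral_shift]); its integrand is continuous since controlled paths are. *)

(** * Convergence in finite dimension *)

Section finite_dimension.
Context {R : realType} (E : normedVectType R).

Lemma continuous_coord (i : 'I_(\dim {:E})) :
  continuous (coord (vbasis {:E}) i : E -> R^o).
Proof.
apply: bounded_linear_continuous; apply/linear_boundedP.
have [C C0 hC] := @linear_bounded_fin _ E R^o (coord (vbasis {:E}) i).
exists C; split; first exact: ger0_real.
by move=> M CM x; rewrite (le_trans (hC x))// ler_wpM2r// ltW.
Qed.

Lemma cvg_coords (T : Type) (G : set_system T) {FG : Filter G} (f : T -> E) :
  (forall i, cvg (coord (vbasis {:E}) i (f x) @[x --> G])) -> cvg (f @ G).
Proof.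
move=> cf.
have -> : f = fun x => \sum_i coord (vbasis {:E}) i (f x) *: (vbasis {:E})`_i.
  by apply/funext => x; rewrite -coord_vbasis ?memvf.
elim: (index_enum _) => [|i r IH].
  by under eq_fun do rewrite big_nil; exact: is_cvg_cst.
under eq_fun do rewrite big_cons.
by apply: is_cvgD => //; apply: is_cvgZr_tmp.
Qed.

(** Completeness of E, in the form of the Cauchy criterion along a filter: the
    coordinates inherit the Cauchy property, because they are bounded linear
    forms, and converge because R is complete. *)
Lemma cauchy_cvg_fin (T : Type) (G : set_system T) {FG : ProperFilter G}
    (f : T -> E) :
  (forall e : R, 0 < e ->
    exists2 A, G A & forall x y, A x -> A y -> `|f x - f y| < e) ->
  cvg (f @ G).
Proof.
move=> cf; apply: cvg_coords => i.
apply: cauchy_cvg; apply/cauchy_exP => e e0.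
have [C C0 hC] := @linear_bounded_fin _ E R^o (coord (vbasis {:E}) i).
have C1 : 0 < C + 1 by rewrite ltr_wpDl.
have [A GA hA] := cf (e / (C + 1)) (divr_gt0 e0 C1).
have [x Ax] := filter_ex GA.
exists (coord (vbasis {:E}) i (f x)).
apply: (@filterS _ G _ A) GA => y Ay; rewrite /= -ball_normE /=.
have -> : coord (vbasis {:E}) i (f x) - coord (vbasis {:E}) i (f y)
    = coord (vbasis {:E}) i (f x - f y) by rewrite linearB.
rewrite (le_lt_trans (hC _))//.
apply: (@le_lt_trans _ _ ((C + 1) * `|f x - f y|)).
  by rewrite ler_wpM2r// lerDl.
by rewrite mulrC -ltr_pdivlMr// hA.
Qed.

End finite_dimension.

(** * Sums over partitions *)

Section partitions.
Context {R : realType}.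
Implicit Types (a b c u v x delta : R) (s t : seq R).

Definition fine_step delta : rel R := fun u v => (u < v) && (v - u < delta).

(** Order and mesh are read off consecutive points rather than indices, so that
    partitions can be cut, concatenated and translated by induction. *)
Definition fine_partition delta a b s :=
  path (fine_step delta) a s && (last a s == b).

Lemma fine_partitionP delta a b s :
  fine_partition delta a b s <->
  itv_partition a b s /\ (forall i, (i < size s)%N ->
    nth b (a :: s) i.+1 - nth b (a :: s) i < delta).
Proof.
rewrite /fine_partition; split.
  move=> /andP[ps ls]; split; first split=> //.
    by apply: sub_path ps => u v /andP[].
  by move=> i si; move/(pathP b): ps => /(_ i si) /andP[].
move=> [[/(pathP b) ps ->] ms]; rewrite andbT; apply/(pathP b) => i si.
by rewrite /fine_step ps//=; exact: ms.
Qed.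

Lemma fine_partition_cat delta a b c s t :
  fine_partition delta a b s -> fine_partition delta b c t ->
  fine_partition delta a c (s ++ t).
Proof.
move=> /andP[ps /eqP ls] /andP[pt lt].
by rewrite /fine_partition cat_path last_cat ls ps pt.
Qed.

Lemma fine_partition_shift delta h a b s :
  fine_partition delta a b s ->
  fine_partition delta (h + a) (h + b) [seq h + x | x <- s].
Proof.
move=> /andP[ps /eqP <-]; rewrite /fine_partition last_map eqxx andbT path_map.
apply: sub_path ps => u v /=.
by rewrite /fine_step /= ltrD2l opprD addrACA subrr add0r.
Qed.

Lemma fine_partition_le d1 d2 a b s : d1 <= d2 ->
  fine_partition d1 a b s -> fine_partition d2 a b s.
Proof.
move=> d12 /andP[ps ls]; rewrite /fine_partition ls andbT.
by apply: sub_path ps => u v /andP[uv d]; rewrite /fine_step uv (lt_le_trans d).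
Qed.

Lemma fine_partition_bounds delta a b s : fine_partition delta a b s -> a <= b.
Proof. by move=> /fine_partitionP[/itv_partition_le]. Qed.

Lemma fine_partition_exists delta a b : a <= b -> 0 < delta ->
  exists s, fine_partition delta a b s.
Proof.
move=> ab /(small_partition_exists ab)[s ps ms].
by exists s; apply/fine_partitionP.
Qed.

Context {E : normedVectType R}.
Implicit Types (A : R -> R -> E).

Lemma partition_sum_nil A a b : partition_sum A a b [::] = 0.
Proof. by rewrite /partition_sum big_nil. Qed.

Lemma partition_sum_cons A a b x s :
  partition_sum A a b (x :: s) = A a x + partition_sum A x b s.
Proof. by rewrite /partition_sum /= big_nat_recl. Qed.

Lemma partition_sum_cat A a b c s t : last a s = b ->
  partition_sum A a c (s ++ t) = partition_sum A a b s + partition_sum A b c t.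
Proof.
elim: s a => [a /= ->|x s IH a /= ls]; first by rewrite partition_sum_nil add0r.
by rewrite !partition_sum_cons IH// addrA.
Qed.

Lemma partition_sum_shift A B h a b s :
  (forall u v, u <= v -> B u v = A (h + u) (h + v)) -> path <%R a s ->
  partition_sum B a b s
  = partition_sum A (h + a) (h + b) [seq h + x | x <- s].
Proof.
move=> AB; elim: s a => [a _|x s IH a /= /andP[ax ps]].
  by rewrite !partition_sum_nil.
by rewrite !partition_sum_cons -IH// AB// ltW.
Qed.

Lemma cvg_partition_sumP A a b (l : E) : a <= b ->
  partition_sum A a b @ small_partitions a b --> l <->
  forall e : R, 0 < e -> exists2 delta, 0 < delta &
    forall s, fine_partition delta a b s -> `|l - partition_sum A a b s| < e.
Proof.
move=> ab; have FF := small_partitions_proper ab; rewrite cvgrPdist_lt; split.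
  move=> h e /h[delta d0 hd]; exists delta => // s /fine_partitionP[]; exact: hd.
move=> h e /h[delta d0 hd]; exists delta => // s ps ms.
by apply: hd; apply/fine_partitionP.
Qed.

Lemma cauchy_partition_sumP A a b : a <= b ->
  cvg (partition_sum A a b @ small_partitions a b) <->
  forall e : R, 0 < e -> exists2 delta, 0 < delta &
    forall s t, fine_partition delta a b s -> fine_partition delta a b t ->
      `|partition_sum A a b s - partition_sum A a b t| < e.
Proof.
move=> ab; have FF := small_partitions_proper ab; split.
  move=> /cvg_ex[l /(cvg_partition_sumP _ _ ab) hl] e e0.
  have [delta d0 hd] := hl (e / 2) (divr_gt0 e0 (ltr0n _ 2)).
  exists delta => // s t /hd hs /hd ht.
  rewrite (splitr e) -(subrK l (partition_sum A a b s)) -addrA.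
  by rewrite (le_lt_trans (ler_normD _ _))// ltrD// distrC.
move=> h; apply: cauchy_cvg_fin => e /h[delta d0 hd].
exists (fine_partition delta a b).
  by exists delta => // s ps ms; apply/fine_partitionP.
by move=> s t; exact: hd.
Qed.

(** Two fine partitions of the middle interval extend by common partitions of
    the outer ones, which cancel in the difference of the two sums. *)
Lemma is_cvg_partition_sum_sub A a b c d : a <= b -> b <= c -> c <= d ->
  cvg (partition_sum A a d @ small_partitions a d) ->
  cvg (partition_sum A b c @ small_partitions b c).
Proof.
move=> ab bc cd.
rewrite (cauchy_partition_sumP _ (le_trans ab (le_trans bc cd))).
rewrite (cauchy_partition_sumP _ bc) => h e /h[delta d0 hd]; exists delta => //.
move=> s t hs ht.
have [p hp] := fine_partition_exists ab d0.
have [q hq] := fine_partition_exists cd d0.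
have := hd _ _ (fine_partition_cat (fine_partition_cat hp hs) hq)
  (fine_partition_cat (fine_partition_cat hp ht) hq).
case/andP: hp hs ht => _ /eqP lp /andP[_ /eqP ls] /andP[_ /eqP lt].
rewrite -!catA !(partition_sum_cat _ _ _ lp).
rewrite (partition_sum_cat _ _ _ ls) (partition_sum_cat _ _ _ lt).
by rewrite opprD addrACA subrr add0r opprD addrACA subrr addr0.
Qed.

(** A partition of [a, c] of small mesh becomes one of [a, b] and one of [b, c]
    on inserting b, which changes at most one term of the sum. *)
Lemma fine_partition_split A delta eta a b c s : 0 <= eta -> a < b -> b < c ->
  (forall u v, a <= u -> u < v -> v <= c -> v - u < delta -> `|A u v| <= eta) ->
  fine_partition delta a c s ->
  exists s1 s2, [/\ fine_partition delta a b s1, fine_partition delta b c s2 &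
    `|partition_sum A a c s
      - (partition_sum A a b s1 + partition_sum A b c s2)| <= 3 * eta].
Proof.
move=> eta0; elim: s a => [|x s IH] a ab bc hA.
  by move=> /andP[_ /eqP /= ac]; move: bc; rewrite -ac ltNge (ltW ab).
move=> hs; have /andP[/= /andP[/andP[ax dax] ps] ls] := hs.
have hxs : fine_partition delta x c s by apply/andP.
have xc := fine_partition_bounds hxs.
have [xb|bx|xb] := ltgtP x b.
- have [u v xu|s1 [s2 [h1 h2 h12]]] := IH x xb bc _ hxs.
    by apply: hA; rewrite (le_trans (ltW ax)).
  exists (x :: s1), s2; split=> //.
    by case/andP: h1 => p1 l1; apply/andP; rewrite /= /fine_step ax dax p1.
  by rewrite !partition_sum_cons -[X in _ - X]addrA opprD addrACA subrr add0r.
- exists [:: b], (x :: s); split.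
  + rewrite /fine_partition /= /fine_step ab eqxx !andbT.
    by rewrite (le_lt_trans _ dax)// lerD2r ltW.
  + rewrite /fine_partition /= /fine_step bx ps ls /= !andbT.
    by rewrite (le_lt_trans _ dax)// lerD2l lerN2 ltW.
  + rewrite !partition_sum_cons partition_sum_nil addr0.
    rewrite (_ : _ - _ = A a x - A a b - A b x); last first.
      by rewrite addrA !opprD !addrA addrAC (addrAC _ _ (- A a b)) addrK.
    rewrite (_ : 3 * eta = eta + eta + eta); last by ring.
    rewrite (le_trans (ler_normB _ _))// lerD//.
      rewrite (le_trans (ler_normB _ _))// lerD//; apply: hA => //.
      * exact: ltW.
      * by rewrite (le_lt_trans _ dax)// lerD2r ltW.
    apply: hA => //; first exact: ltW.
    by rewrite (le_lt_trans _ dax)// lerD2l lerN2 ltW.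
- exists [:: x], s; split.
  + by rewrite /fine_partition /= /fine_step ax dax xb eqxx.
  + by rewrite -xb.
  + rewrite !partition_sum_cons partition_sum_nil addr0 -xb subrr normr0.
    by rewrite mulr_ge0.
Qed.

(** Uniformity in u and v is what makes it possible to control the one term of a
    sum whose interval contains a given point, wherever its end points lie. *)
Definition diag_vanishing (A : R -> R -> E) :=
  forall a b (e : R), 0 < e -> exists2 delta, 0 < delta &
    forall u v, a <= u -> u < v -> v <= b -> v - u < delta -> `|A u v| < e.

Lemma is_cvg_partition_sum_join A a b c : diag_vanishing A ->
  a <= b -> b <= c ->
  cvg (partition_sum A a b @ small_partitions a b) ->
  cvg (partition_sum A b c @ small_partitions b c) ->
  cvg (partition_sum A a c @ small_partitions a c).
Proof.
move=> vA; rewrite le_eqVlt => /predU1P[->//|ab].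
rewrite le_eqVlt => /predU1P[->//|bc].
move=> /cvg_ex[l /(cvg_partition_sumP _ _ (ltW ab)) hl].
move=> /cvg_ex[m /(cvg_partition_sumP _ _ (ltW bc)) hm].
apply/cvg_ex; exists (l + m).
apply/cvg_partition_sumP; first exact: ltW (lt_trans ab bc).
move=> e e0.
(* One share of e for each of the two limits, three for the changed term. *)
have e5 : 0 < e / 5 by rewrite divr_gt0.
have [d1 d10 h1] := hl _ e5; have [d2 d20 h2] := hm _ e5.
have [d3 d30 h3] := vA a c _ e5.
exists (Num.min d1 (Num.min d2 d3)); first by rewrite !lt_min d10 d20.
move=> s hs.
have hA u v : a <= u -> u < v -> v <= c -> v - u < Num.min d1 (Num.min d2 d3) ->
    `|A u v| <= e / 5.
  by move=> ? ? ?; rewrite !lt_min => /and3P[_ _ ?]; exact/ltW/h3.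
have [s1 [s2 [hs1 hs2 h12]]] := fine_partition_split (ltW e5) ab bc hA hs.
have {}hs1 : `|l - partition_sum A a b s1| < e / 5.
  by apply: h1; apply: fine_partition_le hs1; rewrite ge_min lexx.
have {}hs2 : `|m - partition_sum A b c s2| < e / 5.
  by apply: h2; apply: fine_partition_le hs2; rewrite !ge_min lexx orbT.
rewrite (_ : _ - _ = (l - partition_sum A a b s1) + (m - partition_sum A b c s2)
  - (partition_sum A a c s - (partition_sum A a b s1 + partition_sum A b c s2))).
  rewrite (le_lt_trans (ler_normB _ _))//.
  rewrite (le_lt_trans (lerD (ler_normD _ _) (lexx _)))//.
  by move: h12 hs1 hs2; lra.
by rewrite addrACA -opprD opprB [RHS]addrA subrK.
Qed.

(** Convergence on the intervals with one end at 0 gives convergence on every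
    interval: two of them are joined at 0, and then restricted. *)
Lemma is_cvg_partition_sum_from0 A : diag_vanishing A ->
  (forall t : R, cvg (partition_sum A (Num.min 0 t) (Num.max 0 t)
    @ small_partitions (Num.min 0 t) (Num.max 0 t))) ->
  forall a b, a <= b -> cvg (partition_sum A a b @ small_partitions a b).
Proof.
move=> vA hA a b ab.
pose N := Num.max `|a| `|b|.
have N0 : 0 <= N by rewrite le_max normr_ge0.
have NN0 : - N <= 0 by rewrite oppr_le0.
have aN : - N <= a by rewrite lerNl (le_trans (ler_norm _))// normrN le_max lexx.
have bN : b <= N by rewrite (le_trans (ler_norm _))// le_max lexx orbT.
apply: (is_cvg_partition_sum_sub aN ab bN).
apply: (is_cvg_partition_sum_join vA NN0 N0).
  by have := hA (- N); rewrite min_r// max_l.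
by have := hA N; rewrite min_l// max_r.
Qed.

Lemma cvg_partition_sum_shift A B h a b (l : E) : a <= b ->
  (forall u v, u <= v -> B u v = A (h + u) (h + v)) ->
  partition_sum A (h + a) (h + b) @ small_partitions (h + a) (h + b) --> l ->
  partition_sum B a b @ small_partitions a b --> l.
Proof.
move=> ab AB; rewrite !cvg_partition_sumP ?lerD2l// => hl e /hl[delta d0 hd].
exists delta => // s hs.
rewrite (partition_sum_shift _ AB); first exact/hd/fine_partition_shift.
by case/andP: hs => ps _; apply: sub_path ps => u v /andP[].
Qed.

End partitions.

(** * Vanishing of the germ at the diagonal *)

Section diag_vanishing.
Context {R : realType}.

Lemma diag_vanishingD (E : normedVectType R) (A B : R -> R -> E) :
  diag_vanishing A -> diag_vanishing B ->
  diag_vanishing (fun u v => A u v + B u v).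
Proof.
move=> vA vB a b e e0; have e2 : 0 < e / 2 by rewrite divr_gt0.
have [d1 d10 h1] := vA a b _ e2; have [d2 d20 h2] := vB a b _ e2.
exists (Num.min d1 d2) => [|u v au uv vb]; first by rewrite lt_min d10.
rewrite lt_min => /andP[uv1 uv2].
by rewrite (splitr e) (le_lt_trans (ler_normD _ _))// ltrD// ?h1// h2.
Qed.

Lemma diag_vanishing_le (E E' : normedVectType R) (A : R -> R -> E)
    (B : R -> R -> E') :
  (forall a b, exists C : R, forall u v, a <= u -> v <= b -> u < v ->
    `|A u v| <= C * `|B u v|) ->
  diag_vanishing B -> diag_vanishing A.
Proof.
move=> AB vB a b e e0; have [C hC] := AB a b.
have C1 : 0 < `|C| + 1 by rewrite ltr_wpDl.
have [delta d0 hd] := vB a b _ (divr_gt0 e0 C1).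
exists delta => // u v au uv vb /(hd _ _ au uv vb).
rewrite ltr_pdivlMr// mulrC; apply: le_lt_trans.
rewrite (le_trans (hC _ _ au vb uv))// ler_wpM2r//.
by rewrite (le_trans (ler_norm _))// lerDl.
Qed.

Lemma loc_holder_diag_vanishing (E : normedVectType R) (g : R)
    (A : R -> R -> E) :
  0 < g -> loc_holder g A -> diag_vanishing A.
Proof.
move=> g0 hA a b e e0; have [C hC] := hA a b.
have C1 : 0 < `|C| + 1 by rewrite ltr_wpDl.
have eC : 0 < e / (`|C| + 1) by rewrite divr_gt0.
exists ((e / (`|C| + 1)) `^ g^-1); first exact: powR_gt0.
move=> u v au uv vb uvd; apply: (le_lt_trans (hC _ _ au uv vb)).
apply: (@le_lt_trans _ _ ((`|C| + 1) * (v - u) `^ g)).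
  by rewrite ler_wpM2r ?powR_ge0// (le_trans (ler_norm _))// lerDl.
rewrite mulrC -ltr_pdivlMr//.
have -> : e / (`|C| + 1) = ((e / (`|C| + 1)) `^ g^-1) `^ g.
  by rewrite -powRrM mulVf ?gt_eqF// powRr1// ltW.
by rewrite gt0_ltr_powR// nnegrE ?powR_ge0// subr_ge0 ltW.
Qed.

Lemma diag_vanishing_incr_continuous (E : normedVectType R) (f : R -> E) :
  diag_vanishing (incr f) -> continuous f.
Proof.
move=> vf x; apply/cvgrPdist_lt => e e0.
have [delta d0 hd] := vf (x - 1) (x + 1) _ e0.
have m0 : 0 < Num.min 1 delta by rewrite lt_min ltr01.
apply: filterS (nbhsx_ballx x (Num.min 1 delta) m0) => y.
rewrite -ball_normE /= lt_min => /andP[xy1 xyd].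
move: xy1; rewrite ltr_norml => /andP[xy1 yx1].
have [xy|yx|<-] := ltgtP x y; last by rewrite subrr normr0.
- rewrite distrC; apply: hd => //; first lra.
  + by move: xy1; lra.
  + by rewrite -[ltLHS]gtr0_norm ?subr_gt0// distrC.
- apply: hd => //; [by move: yx1; lra | lra |].
  by rewrite -[ltLHS]gtr0_norm ?subr_gt0.
Qed.

Lemma continuous_bounded_itv (E : normedVectType R) (f : R -> E) (a b : R) :
  continuous f -> exists2 C : R, 0 <= C & forall u, a <= u -> u <= b -> `|f u| <= C.
Proof.
move=> cf; have [ab|ba] := leP a b; last first.
  exists 0 => // u au ub.
  by move: (le_lt_trans (le_trans au ub) ba); rewrite ltxx.
have cn : {within `[a, b], continuous (fun u => `|f u|)}.
  apply: continuous_subspaceT => u.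
  by apply: continuous_comp; [exact: cf | exact: norm_continuous].
have [c _ hc] := EVT_max ab cn.
exists `|f c| => // u au ub; apply: hc.
by rewrite in_itv /= au ub.
Qed.

Lemma bounded_fun_norm_le (T : Type) (E : normedVectType R) (f : T -> E) :
  bounded_fun f -> exists2 M : R, 0 <= M & forall x, `|f x| <= M.
Proof. by move=> /pinfty_ex_gt0[M M0 hM]; exists M => [|x]; [exact: ltW|exact: hM]. Qed.

Section controlled_path.
Context {V U : normedVectType R}.
Variables (alpha : R) (X : R -> V) (XX : R -> R -> tensor2 V).
Hypotheses (alpha0 : 0 < alpha) (hX : rough_path alpha X XX).

Lemma controlled_derivative_continuous (Z : R -> U) (Z' : R -> 'Hom(V, U)) :
  controlled alpha X Z Z' -> continuous Z'.
Proof.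
move=> [hZ' _]; apply: diag_vanishing_incr_continuous.
exact: loc_holder_diag_vanishing hZ'.
Qed.

(** In Z_{u,v} = Z'_u X_{u,v} + R_{u,v} both terms vanish at the diagonal. *)
Lemma controlled_diag_vanishing (Z : R -> U) (Z' : R -> 'Hom(V, U)) :
  controlled alpha X Z Z' -> diag_vanishing (incr Z).
Proof.
move=> hZ; have cZ' := controlled_derivative_continuous hZ.
have [hXa _ _] := hX; case: hZ => _ hR.
rewrite (_ : incr Z = fun u v => Z' u (incr X u v) + remainder X Z Z' u v).
  apply: diag_vanishingD; last first.
    by apply: loc_holder_diag_vanishing hR; rewrite mulr_gt0.
  apply: diag_vanishing_le (loc_holder_diag_vanishing alpha0 hXa) => a b.
  have [C C0 hC] := continuous_bounded_itv a b cZ'.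
  exists C => u v au vb uv; rewrite (le_trans (opnorm_ub _ _))// ler_wpM2r//.
  by rewrite -hom_normE hC// (le_trans (ltW uv)).
by apply/funext => u; apply/funext => v; rewrite addrC subrK.
Qed.

Lemma controlled_continuous (Z : R -> U) (Z' : R -> 'Hom(V, U)) :
  controlled alpha X Z Z' -> continuous Z.
Proof.
by move=> hZ; exact/diag_vanishing_incr_continuous/(controlled_diag_vanishing hZ).
Qed.

(** The coefficients of the germ are bounded on compact intervals, and the
    increments that they multiply vanish at the diagonal. *)
Lemma germ_diag_vanishing (W : normedVectType R) (F : W -> 'Hom(U, W))
    (Y : R -> W) (Y' : R -> 'Hom(V, W)) (Z : R -> U) (Z' : R -> 'Hom(V, U)) :
  bounded_fun F -> bounded_fun (Dhom F) -> continuous Y' ->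
  controlled alpha X Z Z' -> diag_vanishing (germ F Y Y' Z Z' XX).
Proof.
move=> /bounded_fun_norm_le[M M0 hM] /bounded_fun_norm_le[D D0 hD] cY' hZ.
have cZ' := controlled_derivative_continuous hZ.
apply: diag_vanishingD.
  apply: diag_vanishing_le (controlled_diag_vanishing hZ) => a b.
  exists M => u v _ _ _; rewrite (le_trans (opnorm_ub _ _))// ler_wpM2r//.
  exact: hM.
have [_ hXX _] := hX.
have vXX : diag_vanishing XX.
  by apply: loc_holder_diag_vanishing hXX; rewrite mulr_gt0.
apply: diag_vanishing_le vXX => a b.
have [K K0 hK] := continuous_bounded_itv a b cY'.
have [L L0 hL] := continuous_bounded_itv a b cZ'.
exists (\sum_i D * (K * `|basis_vec i|) * (L * `|@dual_vec _ V i|)).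
move=> u v au vb uv; have ub : u <= b := le_trans (ltW uv) vb.
rewrite mulr_suml (le_trans (ler_norm_sum _ _ _))//; apply: ler_sum => i _.
have -> : D * (K * `|basis_vec i|) * (L * `|@dual_vec _ V i|) * `|XX u v|
    = (D * (K * `|basis_vec i|)) * (L * (`|XX u v| * `|@dual_vec _ V i|)).
  by ring.
rewrite (le_trans (opnorm_ub _ _))// ler_pM ?opnorm_ge0//.
  rewrite -hom_normE (le_trans (opnorm_ub _ _))// ler_pM ?opnorm_ge0//.
    exact: hD.
  rewrite (le_trans (opnorm_ub _ _))// ler_wpM2r//; exact: hK.
rewrite (le_trans (opnorm_ub _ _))// ler_pM ?opnorm_ge0//; first exact: hL.
exact: opnorm_ub.
Qed.

End controlled_path.
End diag_vanishing.

(** * Translation of Lebesgue integrals *)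

Lemma Rintegral_shift (R : realType) (f : R -> R) (h a b : R) : a <= b ->
  continuous f ->
  \int[lebesgue_measure]_(x in `[h + a, h + b]) f x
  = \int[lebesgue_measure]_(x in `[a, b]) f (h + x).
Proof.
move=> ab cf; have Dh : (fun x : R => h + x)^`()%classic = cst 1.
  by apply/funext => x; rewrite derive1E deriveD// derive_cst derive_id add0r.
rewrite /Rintegral (@integration_by_substitution_increasing _ (fun x => h + x))//.
- by congr fine; apply: eq_integral => x _; rewrite Dh /= mulr1.
- by move=> x y _ _; rewrite ltrD2l.
- by rewrite Dh => x _; exact: cst_continuous.
- by rewrite Dh; exact: is_cvg_cst.
- by rewrite Dh; exact: is_cvg_cst.
- have ch : continuous (fun x : R => h + x).
    by move=> x; apply: cvgD; [exact: cvg_cst | exact: cvg_id].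
  by split=> // [|]; [apply: cvg_at_right_filter|apply: cvg_at_left_filter]; exact: ch.
- exact: continuous_subspaceT.
Qed.

Lemma vintegral_shift (R : realType) (E : normedVectType R) (f : R -> E)
    (h a b : R) : continuous f ->
  vintegral f (h + a) (h + b) = vintegral (fun x => f (h + x)) a b.
Proof.
move=> cf; rewrite /vintegral lerD2l.
have cfi i : continuous (fun r => coord (vbasis {:E}) i (f r)).
  move=> r; apply: continuous_comp; [exact: cf | exact: continuous_coord].
have [ab|/ltW ba] := leP a b; [|congr (- _)];
  by apply: eq_bigr => i _; rewrite (Rintegral_shift _ _ (cfi i)).
Qed.

(** * Cocycles *)

Section germ_shift.
Context {R : realType} {d : measure_display} {Omega : measurableType d}.
Variables (P : probability Omega R) (theta : R -> Omega -> Omega).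
Hypothesis htheta : measure_preserving_system P theta.
Variables (V U : normedVectType R) (alpha : R).
Variables (X : Omega -> R -> V) (XX : Omega -> R -> R -> tensor2 V).
Hypothesis hX : rough_path_cocycle theta alpha X XX.
Variables (Z : Omega -> R -> U) (Z' : Omega -> R -> 'Hom(V, U)).
Hypothesis hZ : controlled_cocycle theta alpha X Z Z'.

(** The cocycle identities concern increments from time 0 to a time t >= 0;
    moving both sides to the base point theta_{h + u} w = theta_u (theta_h w)
    extends them to increments over [u, v] with u of any sign. *)
Lemma rough_path_cocycle_shift w h u v : u <= v ->
  XX (theta h w) u v = XX w (h + u) (h + v).
Proof.
rewrite -subr_ge0 -[in X in _ -> X](subrKC u v); move: (v - u) => e e0.
rewrite addrA !(rpc_cocycle2 hX) //.
by rewrite -(mps_add htheta) addrC.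
Qed.

Lemma controlled_cocycle_shift w h u v : u <= v ->
  incr (Z (theta h w)) u v = incr (Z w) (h + u) (h + v).
Proof.
rewrite -subr_ge0 -[in X in _ -> X](subrKC u v); move: (v - u) => e e0.
rewrite addrA !(cc_cocycle1 hZ) //.
by rewrite -(mps_add htheta) addrC.
Qed.

(** Every time u, negative or not, is time 0 seen from theta_u. *)
Lemma controlled_cocycle_shift_derivative w h u :
  Z' (theta h w) u = Z' w (h + u).
Proof.
rewrite -[u in LHS]addr0 -[h + u]addr0 !(cc_cocycle2 hZ) //.
by rewrite -(mps_add htheta) addrC.
Qed.

Lemma germ_shift (W : normedVectType R) (F : W -> 'Hom(U, W)) (Y : R -> W)
    (Y' : R -> 'Hom(V, W)) w h u v : u <= v ->
  germ F (fun r => Y (h + r)) (fun r => Y' (h + r))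
    (Z (theta h w)) (Z' (theta h w)) (XX (theta h w)) u v
  = germ F Y Y' (Z w) (Z' w) (XX w) (h + u) (h + v).
Proof.
move=> uv; rewrite /germ controlled_cocycle_shift// rough_path_cocycle_shift//.
by rewrite controlled_cocycle_shift_derivative.
Qed.

End germ_shift.

Theorem lemma3p11 (R : realType) (U V W : normedVectType R) (alpha : R)
    (halpha : 3^-1 < alpha <= 2^-1)
    (d : measure_display) (Omega : measurableType d) (P : probability Omega R)
    (theta : R -> Omega -> Omega)
    (htheta : measure_preserving_system P theta)
    (X : Omega -> R -> V) (XX : Omega -> R -> R -> tensor2 V)
    (hX : rough_path_cocycle theta alpha X XX)
    (Z : Omega -> R -> U) (Z' : Omega -> R -> 'Hom(V, U))
    (hZ : controlled_cocycle theta alpha X Z Z')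
    (F : W -> 'Hom(U, W)) (hF : Cb 3 F)
    (F0 : W -> W) (hF0 : Cb 1 F0)
    (Y : Omega -> R -> W) (Y' : Omega -> R -> 'Hom(V, W))
    (hY : forall w, controlled alpha (X w) (Y w) (Y' w))
    (hYint : forall w t,
       cintegrable F (Y w) (Y' w) (Z w) (Z' w) (XX w) 0 t)
    (hYeq : forall w t,
       Y w t = Y w 0 + cintegral F (Y w) (Y' w) (Z w) (Z' w) (XX w) 0 t
                     + vintegral (fun r => F0 (Y w r)) 0 t)
    (hY' : forall w t, Y' w t = (F (Y w t) \o Z' w t)%VF)
    (s : R) :
  let Yt w r := Y w (s + r) in
  let Yt' w r := Y' w (s + r) in
  forall w t,
    [/\ cintegrable F (Y w) (Y' w) (Z w) (Z' w) (XX w) s (s + t),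
        cintegrable F (Yt w) (Yt' w)
          (Z (theta s w)) (Z' (theta s w)) (XX (theta s w)) 0 t,
        cintegral F (Y w) (Y' w) (Z w) (Z' w) (XX w) s (s + t)
        = cintegral F (Yt w) (Yt' w)
            (Z (theta s w)) (Z' (theta s w)) (XX (theta s w)) 0 t
      & vintegral (fun q => F0 (Y w q)) s (s + t)
        = vintegral (fun r => F0 (Yt w r)) 0 t].
Proof.
move=> Yt Yt' w t.
have alpha0 : 0 < alpha by case/andP: halpha => h _; rewrite (lt_trans _ h).
case: (hF) => bF [dF [bDF _]]; case: (hF0) => _ [dF0 _].
have hXw := rpc_rough_path hX w; have hZw := cc_controlled hZ w.
have cY' := controlled_derivative_continuous alpha0 (hY w).
have cY := controlled_continuous alpha0 hXw (hY w).
have vgerm := germ_diag_vanishing alpha0 hXw (Y w) bF bDF cY' hZw.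
have hcvg a b (ab : a <= b) : cvg (partition_sum
    (germ F (Y w) (Y' w) (Z w) (Z' w) (XX w)) a b @ small_partitions a b).
  by apply: is_cvg_partition_sum_from0 vgerm _ a b ab => r; exact: hYint.
have hshift a b (ab : a <= b) : partition_sum (germ F (Yt w) (Yt' w)
      (Z (theta s w)) (Z' (theta s w)) (XX (theta s w))) a b
    @ small_partitions a b -->
    lim (partition_sum (germ F (Y w) (Y' w) (Z w) (Z' w) (XX w)) (s + a) (s + b)
      @ small_partitions (s + a) (s + b)).
  apply: (cvg_partition_sum_shift ab (germ_shift htheta hX hZ F (Y w) (Y' w) w s)).
  by apply: hcvg; rewrite lerD2l.
have hlim a b (ab : a <= b) := cvg_lim (@norm_hausdorff _ _) (hshift a b ab)
  (FF := small_partitions_proper ab).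
split.
- by apply: hcvg; rewrite ge_min le_max lexx.
- by apply/cvg_ex; eexists; apply: hshift; rewrite ge_min le_max lexx.
- rewrite /cintegral lerDl; have [t0|/ltW t0] := leP 0 t.
    by rewrite hlim// addr0.
  by rewrite hlim// addr0.
- rewrite -{1}(addr0 s) vintegral_shift// => r.
  apply: continuous_comp; first exact: cY.
  exact/differentiable_continuous/dF0.
Qed.
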